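(* Let $a$ and $b$ be positive integers such that $b$ divides $a$, and let $q(x)\in\mathbb{Q}(x)$ be a rational function over $\mathbb{Q}$. Then $l(x,q(x))\in\mathbb{Z}[x]$ if and only if \[q(x)\in\Bigl\{\frac{F_i(x)}{F_{i+1}(x)},\ \frac{L_i(x)}{L_{i+1}(x)},\ -\frac{L_{i+1}(x)}{bL_i(x)}\Bigr\}_{i\in\mathbb{N}}\quad\text{or}\quad q(x)\in\Bigl\{-\frac{F_{i+1}(x)}{bF_i(x)}\Bigr\}_{i\in\mathbb{N}^{+}}.\]
   Context: Here $\mathbb{N}=\{0,1,2,\dots\}$ and $\mathbb{N}^{+}=\{1,2,3,\dots\}$. For positive integers $a,b$, the polynomial sequences $\{F_i(x)\}_{i\in\mathbb{N}}$ and $\{L_i(x)\}_{i\in\mathbb{N}}$ in $\mathbb{Z}[x]$ are defined by $F_0(x)=0$, $F_1(x)=1$, $F_{i+2}(x)=ax\,F_{i+1}(x)+b\,F_i(x)$, and $L_0(x)=2$, $L_1(x)=ax$, $L_{i+2}(x)=ax\,L_{i+1}(x)+b\,L_i(x)$, for $i\in\mathbb{N}$. The generating function of $\{L_i(x)\}$ is taken to be the rational expression \[l(x,t)=\frac{2-axt}{1-axt-bt^2},\] so $l(x,q(x))=\dfrac{2-ax\,q(x)}{1-ax\,q(x)-b\,q(x)^2}$ is an element of $\mathbb{Q}(x)$ (no convergence condition is imposed). *)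

(* Defs.v *)
From HB Require Import structures.
From mathcomp Require Import all_boot all_order all_algebra.

Set Implicit Arguments.
Unset Strict Implicit.
Unset Printing Implicit Defensive.

Import GRing.Theory.
Local Open Scope ring_scope.

Notation ratfun := {fraction {poly rat}}.

Fixpoint Fpoly (a b i : nat) : {poly int} :=
  match i with
  | 0 => 0
  | 1 => 1
  | (j.+1 as k).+1 => a%:R * 'X * Fpoly a b k + b%:R * Fpoly a b j
  end.

Fixpoint Lpoly (a b i : nat) : {poly int} :=
  match i with
  | 0 => 2
  | 1 => a%:R * 'X
  | (j.+1 as k).+1 => a%:R * 'X * Lpoly a b k + b%:R * Lpoly a b j
  end.

Definition ratfun_of_zpoly (p : {poly int}) : ratfun :=
  FracField.tofrac (map_poly (intr : int -> rat) p).

Definition ratfunX : ratfun := FracField.tofrac 'X.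

Definition in_Zx (r : ratfun) : Prop :=
  exists p : {poly int}, r = ratfun_of_zpoly p.

(* l(x,q).  For a, b > 0 the denominator is nonzero for every q in Q(x): as a
   polynomial in t, 1 - a x t - b t^2 has discriminant a^2 x^2 + 4 b, which is
   not a square in Q(x).  So the convention r / 0 = 0 plays no role. *)
Definition lgen (a b : nat) (q : ratfun) : ratfun :=
  (2 - a%:R * ratfunX * q) / (1 - a%:R * ratfunX * q - b%:R * q ^+ 2).

(* Main.v *)
Require Import Defs.
From HB Require Import structures.
From mathcomp Require Import all_boot all_order all_algebra.
From mathcomp Require Import generic_quotient ring zify.

Set Implicit Arguments.
Unset Strict Implicit.
Unset Printing Implicit Defensive.

Import Order.TTheory GRing.Theory Num.Theory.
Local Open Scope ring_scope.

(** Solving [l(x, q) = y] for [q] gives the quadratic equation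
    [b y q^2 + a x (y - 1) q + (2 - y) = 0]; clearing the denominator is an
    equivalence because [1 - a x q - b q^2] vanishes for no [q] in [Q(x)].

    Suppose that [y] is a polynomial and put [u = y - 1], [f = y q].  Multiplied
    by [y], the equation becomes [N(u, f) = 1] for the norm form
    [N(g, f) = g^2 - a x f g - b f^2].  In particular [b f] is integral over
    [Q[x]], so [f] is a polynomial, and one is left with a Pell equation over
    [Q[x]].  It is solved by descent on degrees (Fpoly_descent): if
    [deg f < deg g] and [N(g, f)] is constant, then so is [N(f, h)], where
    [g = a x f + b h], and [deg h < deg f].  This undoes the recurrence of the
    [F_i], so [(g, f)] is proportional to [(F_(n+1), F_n)].  Since
    [N(F_(n+1), F_n) = (-b)^n], norm 1 forces [n = 2 k] over an ordered field
    and fixes the constant up to sign: [u = F_(2k+1) / (-b)^k] or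
    [u = - F_(2k+1) / (-b)^k] (norm_one_Fpoly).

    The identity [F_(2k+1) = F_(k+1)^2 + b F_k^2] then gives
    [y = F_(k+1) L_k / (-b)^k] or [y = - F_k L_(k+1) / (-b)^k].  For these
    values of [y] the quadratic splits into linear factors, up to a nonzero
    constant as
    [(F_(k+1) q - F_k) (b L_k q + L_(k+1))] and
    [(L_(k+1) q - L_k) (b F_k q + F_(k+1))] respectively (quadratic_roots_FL,
    quadratic_roots_FLN); the roots are the listed functions, and for [k = 0]
    the last factor is the constant 1, whence the condition [i > 0] on that
    family.

    Conversely all these [y] lie in [Z[x]]: as [b] divides [a], the recurrences
    give [b^(floor(i/2)) | F_i] and [b^(ceil(i/2)) | L_i]. *)

(** * The sequences F and L *)

Lemma FpolySS a b i :
  Fpoly a b i.+2 = a%:R * 'X * Fpoly a b i.+1 + b%:R * Fpoly a b i.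
Proof. by []. Qed.

Lemma LpolySS a b i :
  Lpoly a b i.+2 = a%:R * 'X * Lpoly a b i.+1 + b%:R * Lpoly a b i.
Proof. by []. Qed.

Lemma Lpoly_Fpoly a b i :
  Lpoly a b i = 2 * Fpoly a b i.+1 - a%:R * 'X * Fpoly a b i
  /\ Lpoly a b i.+1 = a%:R * 'X * Fpoly a b i.+1 + 2 * b%:R * Fpoly a b i.
Proof.
elim: i => [|i [IH0 IH1]]; first by rewrite /=; split; ring.
by rewrite LpolySS IH0 IH1 FpolySS; split; ring.
Qed.

Lemma Fpoly_norm a b i :
  Fpoly a b i.+1 ^+ 2 - a%:R * 'X * Fpoly a b i * Fpoly a b i.+1
    - b%:R * Fpoly a b i ^+ 2 = (- b%:R) ^+ i.
Proof.
elim: i => [|i IH]; first by rewrite /=; ring.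
by rewrite [RHS]exprS -IH FpolySS; ring.
Qed.

(** The recurrence has order two, so the induction must carry two consecutive
    indices; the second formula serves only this purpose. *)
Lemma Fpoly_double a b k :
  Fpoly a b k.*2.+1 = Fpoly a b k.+1 ^+ 2 + b%:R * Fpoly a b k ^+ 2
  /\ Fpoly a b k.*2.+2 = Fpoly a b k.+1 *
       (a%:R * 'X * Fpoly a b k.+1 + 2 * b%:R * Fpoly a b k).
Proof.
elim: k => [|k [IH0 IH1]]; first by rewrite /=; split; ring.
have E : Fpoly a b k.+1.*2.+1 = Fpoly a b k.+2 ^+ 2 + b%:R * Fpoly a b k.+1 ^+ 2.
  by rewrite doubleS FpolySS IH0 IH1 FpolySS; ring.
split=> //; rewrite FpolySS E doubleS IH1 (FpolySS _ _ k); ring.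
Qed.

(** Evaluation at 1 shows that the polynomials in the denominators are nonzero. *)
Lemma Fpoly_gt0 a b i : (0 < b)%N -> (0 < a)%N -> (Fpoly a b i.+1).[1] > 0.
Proof.
move=> hb ha; suff: (0 <= (Fpoly a b i).[1]) && (0 < (Fpoly a b i.+1).[1]).
  by case/andP.
elim: i => [|i /andP[IH0 IH1]]; first by rewrite /= !hornerE.
rewrite (ltW IH1) FpolySS !hornerE !hornerMn !hornerE.
by rewrite ltr_pwDl // ?mulr_gt0 ?mulr_ge0 ?ltr0n.
Qed.

Lemma Lpoly_gt0 a b i : (0 < b)%N -> (0 < a)%N -> (Lpoly a b i).[1] > 0.
Proof.
move=> hb ha; suff: (0 < (Lpoly a b i).[1]) && (0 < (Lpoly a b i.+1).[1]).
  by case/andP.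
elim: i => [|i /andP[IH0 IH1]].
  by rewrite /= !hornerE !hornerMn !hornerE ltr0n ha.
by rewrite IH1 LpolySS !hornerE !hornerMn !hornerE addr_gt0 // mulr_gt0 ?ltr0n.
Qed.

(** Each coefficient of the recurrence contributes a factor [b], but the step
    advances the index by two, hence the exponent growing like [i / 2].  The
    offset [r] covers both sequences: 0 for F and 1 for L. *)
Lemma recurrence_dvd a b (s : nat -> {poly int}) r :
    (b %| a)%N ->
    (forall i, s i.+2 = a%:R * 'X * s i.+1 + b%:R * s i) ->
    (exists p, s 0 = b%:R ^+ r./2 * p) ->
    (exists p, s 1 = b%:R ^+ r.+1./2 * p) ->
  forall i, exists p, s i = b%:R ^+ (i + r)./2 * p.
Proof.
case/dvdnP=> c -> sSS s0 s1 i.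
suff: (exists p, s i = b%:R ^+ (i + r)./2 * p)
    /\ (exists p, s i.+1 = b%:R ^+ (i + r).+1./2 * p) by case.
elim: i => [|i [[p Hp] [p' Hp']]] //; split; first by exists p'; rewrite addSn.
have [d Hd] : exists d, ((i + r).+1./2 = (i + r)./2 + d)%N.
  by exists ((i + r).+1./2 - (i + r)./2)%N; lia.
exists (c%:R * 'X * b%:R ^+ d * p' + p).
have -> : ((i.+1 + r).+1./2 = (i + r)./2.+1)%N by [].
by rewrite sSS Hp Hp' natrM Hd exprS exprD; ring.
Qed.

Lemma dvdb_Fpoly a b i : (b %| a)%N -> exists p, Fpoly a b i = b%:R ^+ i./2 * p.
Proof.
move=> hab; have := @recurrence_dvd a b (Fpoly a b) 0 hab (FpolySS a b) _ _ i.
by rewrite addn0; apply; [exists 0; rewrite mulr0|exists 1; rewrite mulr1].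
Qed.

Lemma dvdb_Lpoly a b i :
  (b %| a)%N -> exists p, Lpoly a b i = b%:R ^+ uphalf i * p.
Proof.
move=> hab; have := @recurrence_dvd a b (Lpoly a b) 1 hab (LpolySS a b) _ _ i.
rewrite addn1; apply; first by exists 2; rewrite mul1r.
by case/dvdnP: hab => c ->; exists (c%:R * 'X); rewrite /= natrM; ring.
Qed.

(** * The Pell equation over K[x] *)

(** With [b h = g - a x f] one has [N(g, f) = - b N(f, h)] and
    [g (b h) = N(g, f) + b f^2].  The right-hand side has at most twice the
    degree of [f], so [deg h < deg f] follows from [deg f < deg g], and the
    descent ends at [f = 0], where [g] is a constant. *)
Lemma Fpoly_descent (a b : nat) (K : fieldType) (c : K) (g f : {poly K}) :
    b%:R != 0 :> K -> (size f < size g)%N ->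
    g ^+ 2 - a%:R * 'X * f * g - b%:R * f ^+ 2 = c%:P ->
  exists n (lam : K), g = lam *: map_poly intr (Fpoly a b n.+1)
                   /\ f = lam *: map_poly intr (Fpoly a b n).
Proof.
move=> b0; have [m] := ubnP (size f); elim: m c f g => // m IH c f g lt_fm lt_fg N.
have [f0|f0] := eqVneq f 0.
  have g0 : g != 0 by rewrite -size_poly_gt0; apply: leq_trans lt_fg.
  have: (size (g * g)%R <= 1)%N.
    move: N; rewrite f0 expr0n /= !(mulr0, mul0r) !subr0 -expr2 => ->.
    exact: size_polyC_leq1.
  rewrite size_mul // => sg.
  have /size_poly1P[lam lam0 ->] : size g == 1%N.
    rewrite eqn_leq size_poly_gt0 g0 andbT.
    by move: sg; case: (size g) => [|[|s]] //; rewrite addnS.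
  by exists 0, lam; rewrite f0 /= rmorph1 rmorph0 alg_polyC scaler0.
pose h := b%:R^-1 *: (g - a%:R * 'X * f).
have bh : b%:R * h = g - a%:R * 'X * f.
  by rewrite /h -mul_polyC mulrA -(polyC_natr K b) -polyCM mulfV // mul1r.
have gE : g = a%:R * 'X * f + b%:R * h by rewrite bh; ring.
have bP : b%:R != 0 :> {poly K} by rewrite -(polyC_natr K b) polyC_eq0.
have gh : g * h * b%:R = c%:P + b%:R * f ^+ 2.
  by rewrite -N -mulrA (mulrC h) bh; ring.
have lt_hf : (size h < size f)%N.
  have [->|h0] := eqVneq h 0; first by rewrite size_poly0 size_poly_gt0.
  have g0 : g != 0 by rewrite -size_poly_gt0; apply: leq_trans lt_fg.
  have : (size (g * h * b%:R)%R <= (size f + size f).-1)%N.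
    rewrite gh (leq_trans (size_polyD _ _)) // geq_max; apply/andP; split.
      apply: leq_trans (size_polyC_leq1 _) _.
      by move: f0; rewrite -size_poly_gt0; case: (size f) => // ? _; rewrite addSn addnS.
    rewrite -(polyC_natr K b) mul_polyC.
    apply: leq_trans (size_scale_leq _ _) _; rewrite expr2; exact: size_polyMleq.
  rewrite -(polyC_natr K b) mulrC mul_polyC size_scale // size_mul //.
  move: lt_fg f0 g0 h0; rewrite -!size_poly_gt0.
  by move: (size f) (size g) (size h) => x y z; lia.
have [||n [lam [fE hE]]] := IH (- (c / b%:R)) h f _ lt_hf.
- by apply: leq_trans lt_hf _; rewrite -ltnS.
- apply: (mulfI bP); have -> : b%:R * (- (c / b%:R))%:P = - c%:P :> {poly K}.
    by rewrite -(polyC_natr K b) -polyCM mulrN mulrC divfK // polyCN.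
  by rewrite -N gE; ring.
exists n.+1, lam; rewrite {1}gE fE hE; split=> //.
rewrite FpolySS rmorphD !rmorphM !rmorph_nat /= map_polyX -!mul_polyC; ring.
Qed.

(** The equation is quadratic in [f], with a second root [f'] satisfying
    [f + f' = - a x g / b] and [f f' = (1 - g^2) / b].  The sum has degree
    [deg g + 1] and the product degree at most [2 deg g], so one of the two roots
    has degree smaller than [g], and the descent applies to it. *)
Lemma norm_one_Fpoly (a b : nat) (K : realFieldType) (g f : {poly K}) :
    (0 < a)%N -> (0 < b)%N ->
    g ^+ 2 - a%:R * 'X * f * g - b%:R * f ^+ 2 = 1 ->
  exists k (s : bool),
    (- b%:R) ^+ k * g = (-1) ^+ s * map_poly intr (Fpoly a b k.*2.+1).
Proof.
move=> ha hb N.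
have b0 : b%:R != 0 :> K by rewrite pnatr_eq0 -lt0n.
have a0 : a%:R != 0 :> K by rewrite pnatr_eq0 -lt0n.
have bK : b%:R * (b%:R^-1)%:P = 1 :> {poly K}.
  by rewrite -(polyC_natr K b) -polyCM mulfV.
have g0 : g != 0.
  apply/eqP => g0; move/(congr1 (horner^~ 0)): N.
  rewrite g0 expr0n /= mulr0 !sub0r oppr0 add0r.
  rewrite hornerN hornerM horner_exp -(polyC_natr K b) !hornerC => E.
  by have := mulr_ge0 (ler0n K b) (sqr_ge0 f.[0]); rewrite -oppr_le0 E ler10.
have [f1 lt_f1g N1] : exists2 f1 : {poly K}, (size f1 < size g)%N &
    g ^+ 2 - a%:R * 'X * f1 * g - b%:R * f1 ^+ 2 = 1.
  (* f' is the second root of the equation in f. *)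
  pose f' : {poly K} := - ((b%:R^-1)%:P * (a%:R * 'X * g) + f).
  have bf' : b%:R * f' = - (a%:R * 'X * g + b%:R * f).
    by rewrite /f' mulrN mulrDr mulrA bK mul1r.
  have N' : g ^+ 2 - a%:R * 'X * f' * g - b%:R * f' ^+ 2 = 1.
    transitivity (g ^+ 2 + f * (b%:R * f')
                  - f' * (b%:R * f' + (a%:R * 'X * g + b%:R * f))); first by ring.
    by rewrite bf' -[RHS]N; ring.
  have ff' : f * f' * b%:R = 1 - g ^+ 2.
    by rewrite -[X in _ = X - _]N -mulrA (mulrC f') bf'; ring.
  have [lt|le_gf] := ltnP (size f) (size g); first by exists f.
  exists f' => //.
  have [->|f'0] := eqVneq f' 0; first by rewrite size_poly0 size_poly_gt0.
  have f0 : f != 0.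
    by rewrite -size_poly_gt0; apply: leq_trans le_gf; rewrite size_poly_gt0.
  have le_prod : ((size f + size f').-1 <= (size g + size g).-1)%N.
    have <- : size (f * f' * b%:R) = (size f + size f').-1.
      by rewrite -(polyC_natr K b) mulrC mul_polyC size_scale // size_mul.
    rewrite ff' (leq_trans (size_polyD _ _)) // size_polyN geq_max size_poly1.
    rewrite expr2 size_polyMleq andbT.
    by move: g0; rewrite -size_poly_gt0; case: (size g) => // ? _; rewrite addSn addnS.
  have le_sum : ((size g).+1 <= maxn (size f) (size f'))%N.
    have <- : size ((b%:R^-1)%:P * (a%:R * 'X * g)) = (size g).+1.
      rewrite mul_polyC size_scale ?invr_eq0 // -(polyC_natr K a) -mulrA.
      by rewrite mul_polyC size_scale // mulrC size_mulX.
    have -> : (b%:R^-1)%:P * (a%:R * 'X * g) = - f - f' by rewrite /f'; ring.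
    by rewrite (leq_trans (size_polyD _ _)) // !size_polyN.
  move: le_gf le_prod le_sum f0 f'0 g0; rewrite -!size_poly_gt0.
  by move: (size f) (size g) (size f') => x y z; lia.
have [n [lam [gE fE]]] := Fpoly_descent (c := 1) b0 lt_f1g N1.
have lam_norm : lam ^+ 2 * (- b%:R) ^+ n = 1.
  apply: (@polyC_inj K); rewrite polyCM !rmorphXn rmorphN /= polyC_natr -[RHS]N1.
  have := congr1 (map_poly (intr : int -> K)) (Fpoly_norm a b n).
  rewrite gE fE -!mul_polyC; move: (Fpoly a b n) (Fpoly a b n.+1) => F F'.
  rewrite !(rmorphB, rmorphM, rmorphXn, rmorphN, rmorph_nat) /= map_polyX => <-.
  by ring.
(* For odd n the left-hand side of lam_norm would be nonpositive. *)
have even_n : ~~ odd n.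
  apply/negP => odd_n.
  move: lam_norm; rewrite exprNn -signr_odd odd_n expr1 mulN1r => E.
  have := mulr_ge0 (sqr_ge0 lam) (exprn_ge0 n (ler0n K b)).
  by rewrite -oppr_le0 -mulrN E ler10.
exists n./2.
have nE := even_halfK even_n.
have : (lam * (- b%:R) ^+ n./2) ^+ 2 == 1.
  by rewrite exprMn -exprM muln2 nE lam_norm.
have -> : (- b%:R) ^+ n./2 * g = (lam * (- b%:R) ^+ n./2)%:P *
    map_poly intr (Fpoly a b n.+1).
  by rewrite gE polyCM rmorphXn rmorphN /= polyC_natr -mul_polyC; ring.
rewrite nE sqrf_eq1 => /orP[] /eqP->; first by exists false.
by exists true; rewrite polyCN expr1.
Qed.

(** * The field of rational functions *)

Lemma fraction_repr (R : idomainType) (x : {fraction R}) :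
  exists n d, d != 0 /\ x * FracField.tofrac d = FracField.tofrac n.
Proof.
elim/quotW: x => r; exists (frac r).1, (frac r).2.
split; first exact: denom_ratioP.
rewrite -[_ * _]/(FracField.mul _ _) !piE.
apply/eqmodP; rewrite /= FracField.equivfE.
rewrite !numden_Ratio ?(oner_eq0, mulf_neq0, denom_ratioP) //.
by rewrite !mulr1 mulrC.
Qed.

Lemma polynomial_integrally_closed (K : fieldType) (x : {fraction {poly K}})
    (p r : {poly K}) :
    x ^+ 2 + FracField.tofrac p * x + FracField.tofrac r = 0 ->
  exists y, x = FracField.tofrac y.
Proof.
have [n [d [d0 xd]]] := fraction_repr x => xE.
pose c := gcdp n d.
have c0 : c != 0 by rewrite gcdp_eq0 negb_and d0 orbT.
have nE : n = n %/ c * c by rewrite divpK ?dvdp_gcdl.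
have dE : d = d %/ c * c by rewrite divpK ?dvdp_gcdr.
have : coprimep (d %/ c) (n %/ c).
  by rewrite coprimep_sym coprimep_div_gcd // d0 orbT.
have : x * FracField.tofrac (d %/ c) = FracField.tofrac (n %/ c).
  apply: (mulIf (x := FracField.tofrac c)); first by rewrite tofrac_eq0.
  by rewrite -mulrA -!rmorphM /= -dE -nE.
have : d %/ c != 0 by apply: contraNneq d0 => d'0; rewrite dE d'0 mul0r.
move: (n %/ c) (d %/ c) => {c c0 nE dE d0 xd} n' d' d'0 xd cop.
(* The equation times d'^2 reads n'^2 = - (p n' + r d') d', and d', n' are coprime. *)
have dvd_dn : d' %| n'.
  rewrite -(Gauss_dvdpr n' cop); apply/dvdpP; exists (- (p * n' + r * d')).
  apply/eqP; rewrite -tofrac_eq !(rmorphM, rmorphD, rmorphN) /= -xd -subr_eq0.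
  rewrite [X in X == 0](_ : _ = (x ^+ 2 + FracField.tofrac p * x
     + FracField.tofrac r) * FracField.tofrac d' ^+ 2); last by ring.
  by rewrite xE mul0r.
exists (n' %/ d'); apply: (mulIf (x := FracField.tofrac d')).
  by rewrite tofrac_eq0.
by rewrite xd -rmorphM /= divpK.
Qed.

HB.instance Definition _ := GRing.RMorphism.copy ratfun_of_zpoly
  (@FracField.tofrac {poly rat} \o map_poly (intr : int -> rat)).

Lemma ratfun_of_zpolyX : ratfun_of_zpoly 'X = ratfunX.
Proof. by rewrite /ratfun_of_zpoly map_polyX. Qed.

Lemma ratfun_of_zpoly_neq0 (p : {poly int}) : 0 < p.[1] -> ratfun_of_zpoly p != 0.
Proof.
move=> p1; rewrite /ratfun_of_zpoly tofrac_eq0; apply: contraTneq p1 => p0.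
have : ((p.[1])%:~R : rat) == 0.
  by rewrite -[1](rmorph1 (intr : int -> rat)) -horner_map /= p0 horner0.
by rewrite intr_eq0 => /eqP->; rewrite ltxx.
Qed.

(** * The quadratic equation for q *)

(** If the denominator vanished, [P = b q] would satisfy [P (P + a x) = b], hence
    be a polynomial.  Both factors would then be constant, but they differ by
    [a x]. *)
Lemma lgen_denom_neq0 a b (q : ratfun) : (0 < a)%N -> (0 < b)%N ->
  1 - a%:R * ratfunX * q - b%:R * q ^+ 2 != 0.
Proof.
move=> ha hb; apply/eqP => E.
have [|P qP] := @polynomial_integrally_closed rat (b%:R * q) (a%:R * 'X) (- b%:R).
  rewrite !(rmorphM, rmorphN, rmorph_nat) /= -/ratfunX.
  rewrite [LHS](_ : _ = - b%:R * (1 - a%:R * ratfunX * q - b%:R * q ^+ 2)).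
    by rewrite E mulr0.
  by ring.
have {}E : P * (P + a%:R * 'X) = b%:R.
  apply/eqP; rewrite -tofrac_eq !(rmorphM, rmorphD, rmorph_nat) /= -/ratfunX -qP.
  rewrite -subr_eq0 [X in X == 0](_ : _ = - b%:R * (1 - a%:R * ratfunX * q - b%:R * q ^+ 2)).
    by rewrite E mulr0.
  by ring.
have b0 : b%:R != 0 :> rat by rewrite pnatr_eq0 -lt0n.
have a0 : a%:R != 0 :> rat by rewrite pnatr_eq0 -lt0n.
have PQ0 : P * (P + a%:R * 'X) != 0.
  by rewrite E -(polyC_natr rat b) polyC_eq0.
have [P0 Q0] : P != 0 /\ P + a%:R * 'X != 0.
  by apply/andP; rewrite -negb_or -mulf_eq0.
have : size (P * (P + a%:R * 'X)) = 1.
  by rewrite E -(polyC_natr rat b) size_polyC b0.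
have s2 : size (a%:R * 'X : {poly rat}) = 2.
  by rewrite -(polyC_natr rat a) mul_polyC size_scale // size_polyX.
rewrite size_mul //.
have := @size_polyDl rat (a%:R * 'X) P; rewrite s2 (addrC _ P).
move: P0 Q0; rewrite -!size_poly_gt0.
by move: (size P) (size (P + _)) => x y; lia.
Qed.

Lemma lgen_quadratic a b (q y : ratfun) : (0 < a)%N -> (0 < b)%N ->
  lgen a b q = y <->
  b%:R * y * q ^+ 2 + a%:R * ratfunX * (y - 1) * q + (2 - y) = 0.
Proof.
move=> ha hb; have d0 := lgen_denom_neq0 q ha hb; rewrite /lgen.
transitivity (2 - a%:R * ratfunX * q =
    y * (1 - a%:R * ratfunX * q - b%:R * q ^+ 2)); last first.
  split=> [E|E]; [rewrite -[RHS](subrr (2 - a%:R * ratfunX * q)) {2}E|].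
    by ring.
  by apply/eqP; rewrite -subr_eq0 -E; apply/eqP; ring.
split=> [<-|->]; first by rewrite divfK.
by rewrite mulfK.
Qed.

Lemma linear_root_eq (K : fieldType) (q n d : K) :
  d != 0 -> (d * q - n == 0) = (q == n / d).
Proof.
move=> d0; rewrite subr_eq0 mulrC; apply/eqP/eqP => [<-|->]; last by rewrite divfK.
by rewrite mulfK.
Qed.

(** The two sets of roots, in any field: [s] stands for [a x], and
    [f, g, l, l', e] for [F_k, F_(k+1), L_k, L_(k+1), (-b)^k]. *)
Section Quadratic.

Variables (K : fieldType) (s b f g l l' e : K).
Hypotheses (eE : e = g ^+ 2 - s * f * g - b * f ^+ 2) (e0 : e != 0).
Hypotheses (lE : l = 2 * g - s * f) (l'E : l' = s * g + 2 * b * f).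

Let quadE z q : (b * z * q ^+ 2 + s * (z - 1) * q + (2 - z)) * e
  = b * (z * e) * q ^+ 2 + s * (z * e - e) * q + (2 * e - z * e).
Proof. by ring. Qed.

Lemma quadratic_roots_FL q z : z = g * l / e -> g != 0 -> b * l != 0 ->
  b * z * q ^+ 2 + s * (z - 1) * q + (2 - z) = 0 <->
  q = f / g \/ q = - (l' / (b * l)).
Proof.
move=> zE g0 bl0; have {}zE : z * e = g * l by rewrite zE divfK.
have E : (b * z * q ^+ 2 + s * (z - 1) * q + (2 - z)) * e
    = (g * q - f) * (b * l * q - - l').
  by rewrite quadE zE eE lE l'E; ring.
rewrite -mulNr; split=> [H|H].
  move/eqP: E; rewrite H mul0r eq_sym mulf_eq0 !linear_root_eq //.
  by case/orP=> /eqP; [left|right].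
apply: (mulIf e0); rewrite mul0r E; apply/eqP; rewrite mulf_eq0 !linear_root_eq //.
by case: H => ->; rewrite eqxx ?orbT.
Qed.

Lemma quadratic_roots_FLN q z : z = - (f * l') / e -> l' != 0 ->
  b * z * q ^+ 2 + s * (z - 1) * q + (2 - z) = 0 <->
  q = l / l' \/ b * f * q - - g = 0.
Proof.
move=> zE l'0; have {}zE : z * e = - (f * l') by rewrite zE divfK.
have E : (b * z * q ^+ 2 + s * (z - 1) * q + (2 - z)) * e
    = - ((l' * q - l) * (b * f * q - - g)).
  by rewrite quadE zE eE lE l'E; ring.
split=> [H|H].
  move/eqP: E; rewrite H mul0r eq_sym oppr_eq0 mulf_eq0 linear_root_eq //.
  by case/orP=> /eqP; [left|right].
apply: (mulIf e0); rewrite mul0r E; apply/eqP.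
rewrite oppr_eq0 mulf_eq0 linear_root_eq //.
by case: H => ->; rewrite eqxx ?orbT.
Qed.

End Quadratic.

(** * The values of l(x, q) on the listed functions *)

Section Parametrization.

Variables (a b : nat) (ha : (0 < a)%N) (hb : (0 < b)%N).

Local Notation F i := (ratfun_of_zpoly (Fpoly a b i)).
Local Notation L i := (ratfun_of_zpoly (Lpoly a b i)).

Lemma ratfun_nat_neq0 : b%:R != 0 :> ratfun.
Proof.
rewrite -(rmorph_nat (@FracField.tofrac {poly rat})) tofrac_eq0.
by rewrite -(polyC_natr rat b) polyC_eq0 pnatr_eq0 -lt0n.
Qed.

Lemma ratfun_Fpoly_neq0 k : F k.+1 != 0.
Proof. exact/ratfun_of_zpoly_neq0/Fpoly_gt0. Qed.

Lemma ratfun_Lpoly_neq0 k : L k != 0.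
Proof. exact/ratfun_of_zpoly_neq0/Lpoly_gt0. Qed.

Lemma ratfun_Fpoly_norm k :
  (- b%:R) ^+ k = F k.+1 ^+ 2 - a%:R * ratfunX * F k * F k.+1 - b%:R * F k ^+ 2.
Proof.
have := congr1 ratfun_of_zpoly (Fpoly_norm a b k).
move: (Fpoly a b k) (Fpoly a b k.+1) => f g.
by rewrite !(rmorphB, rmorphM, rmorphXn, rmorphN, rmorph_nat) /= ratfun_of_zpolyX.
Qed.

Lemma ratfun_Lpoly k :
  L k = 2 * F k.+1 - a%:R * ratfunX * F k
  /\ L k.+1 = a%:R * ratfunX * F k.+1 + 2 * b%:R * F k.
Proof.
have [-> ->] := Lpoly_Fpoly a b k; move: (Fpoly a b k) (Fpoly a b k.+1) => f g.
by rewrite !(rmorphB, rmorphD, rmorphM, rmorph_nat, rmorph1) /= ratfun_of_zpolyX.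
Qed.

Lemma ratfun_expNb_neq0 k : (- b%:R) ^+ k != 0 :> ratfun.
Proof. by rewrite expf_neq0 // oppr_eq0 ratfun_nat_neq0. Qed.

Lemma lgen_eq_FL k q :
  lgen a b q = F k.+1 * L k / (- b%:R) ^+ k <->
  q = F k / F k.+1 \/ q = - (L k.+1 / (b%:R * L k)).
Proof.
have [LE LE'] := ratfun_Lpoly k; rewrite (lgen_quadratic _ _ ha hb).
exact: (quadratic_roots_FL (ratfun_Fpoly_norm k) (ratfun_expNb_neq0 k) LE LE'
  q (erefl _) (ratfun_Fpoly_neq0 k)
  (mulf_neq0 ratfun_nat_neq0 (ratfun_Lpoly_neq0 k))).
Qed.

Lemma lgen_eq_FLN k q :
  lgen a b q = - (F k * L k.+1) / (- b%:R) ^+ k <->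
  q = L k / L k.+1 \/ (0 < k)%N /\ q = - (F k.+1 / (b%:R * F k)).
Proof.
have [LE LE'] := ratfun_Lpoly k; rewrite (lgen_quadratic _ _ ha hb).
rewrite (quadratic_roots_FLN (ratfun_Fpoly_norm k) (ratfun_expNb_neq0 k) LE LE'
  q (erefl _) (ratfun_Lpoly_neq0 k.+1)).
suff -> : b%:R * F k * q - - F k.+1 = 0 <->
  (0 < k)%N /\ q = - (F k.+1 / (b%:R * F k)) by [].
case: k {LE LE'} => [|k].
  have := ratfun_Fpoly_neq0 0; rewrite rmorph0; move: (F 1) => g g0.
  rewrite mulr0 mul0r sub0r opprK.
  by split=> [/eqP|[]//]; rewrite (negbTE g0).
rewrite -(mulNr (F k.+2)).
split=> [/eqP|[_ ->]].
  by rewrite (linear_root_eq _ _ (mulf_neq0 ratfun_nat_neq0 (ratfun_Fpoly_neq0 k))) => /eqP.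
apply/eqP; rewrite (linear_root_eq _ _ (mulf_neq0 ratfun_nat_neq0 (ratfun_Fpoly_neq0 k))).
exact: eqxx.
Qed.

Lemma in_Zx_div_expNb k m (p : {poly int}) : (k <= m)%N ->
  in_Zx (ratfun_of_zpoly (b%:R ^+ m * p) / (- b%:R) ^+ k).
Proof.
move=> le_km; exists ((-1) ^+ k * b%:R ^+ (m - k) * p).
apply: (mulIf (ratfun_expNb_neq0 k)); rewrite divfK ?ratfun_expNb_neq0 //.
have -> : (- b%:R) ^+ k = ratfun_of_zpoly ((- b%:R) ^+ k).
  by rewrite rmorphXn rmorphN rmorph_nat.
rewrite -rmorphM; congr ratfun_of_zpoly.
transitivity ((- b%:R) ^+ k * (-1) ^+ k * b%:R ^+ (m - k) * p); last by ring.
by rewrite -exprMn mulrN1 opprK -exprD subnKC.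
Qed.

(** The exponents of [b] available are [k.+1./2 + uphalf k = 2 * uphalf k] and
    [k./2 + uphalf k.+1 = 2 * k./2 + 1], both at least [k]. *)
Lemma in_Zx_FL k : (b %| a)%N ->
  in_Zx (F k.+1 * L k / (- b%:R) ^+ k)
  /\ in_Zx (- (F k * L k.+1) / (- b%:R) ^+ k).
Proof.
move=> hab; split.
  have [p pE] := dvdb_Fpoly k.+1 hab; have [p' p'E] := dvdb_Lpoly k hab.
  rewrite -rmorphM.
  have -> : Fpoly a b k.+1 * Lpoly a b k = b%:R ^+ (k.+1./2 + uphalf k) * (p * p').
    by rewrite pE p'E exprD; ring.
  by apply: in_Zx_div_expNb; lia.
have [p pE] := dvdb_Fpoly k hab; have [p' p'E] := dvdb_Lpoly k.+1 hab.
rewrite -rmorphM -rmorphN.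
have -> : - (Fpoly a b k * Lpoly a b k.+1)
    = b%:R ^+ (k./2 + uphalf k.+1) * - (p * p').
  by rewrite pE p'E exprD; ring.
by apply: in_Zx_div_expNb; lia.
Qed.

(** * The polynomial values of l(x, q) *)

(** Only the direction producing [k] uses the Pell equation: it is applied to
    [u = y - 1] and [f = y q]. *)
Lemma lgen_in_Zx q : (b %| a)%N ->
  in_Zx (lgen a b q) <->
  exists k, lgen a b q = F k.+1 * L k / (- b%:R) ^+ k
         \/ lgen a b q = - (F k * L k.+1) / (- b%:R) ^+ k.
Proof.
move=> hab; split=> [[Y yE]|[k [->|->]]]; last 2 first.
- exact: (in_Zx_FL k hab).1.
- exact: (in_Zx_FL k hab).2.
have := (lgen_quadratic q (ratfun_of_zpoly Y) ha hb).1 yE.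
rewrite {}yE.
have [y ->] : exists y : {poly rat}, ratfun_of_zpoly Y = FracField.tofrac y.
  by exists (map_poly intr Y).
move=> {Y} quad.
pose u := y - 1.
(* bf is b times the second component f = y q of the Pell solution. *)
pose bf := b%:R * FracField.tofrac y * q.
have bfE : bf ^+ 2 + FracField.tofrac (a%:R * 'X * u) * bf
    + FracField.tofrac (b%:R * (1 - u ^+ 2)) = 0.
  rewrite /u !(rmorphM, rmorphB, rmorphXn, rmorph_nat, rmorph1) /= -/ratfunX /bf.
  rewrite -[RHS](mulr0 (b%:R * FracField.tofrac y)) -quad.
  by ring.
have [P PE] := polynomial_integrally_closed bfE.
have bK : b%:R * (b%:R^-1)%:P = 1 :> {poly rat}.
  by rewrite -(polyC_natr rat b) -polyCM mulfV // pnatr_eq0 -lt0n.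
pose f := (b%:R^-1)%:P * P.
have Pf : P = b%:R * f by rewrite /f mulrA bK mul1r.
have N : u ^+ 2 - a%:R * 'X * f * u - b%:R * f ^+ 2 = 1.
  have {}bfE : P ^+ 2 + a%:R * 'X * u * P + b%:R * (1 - u ^+ 2) = 0.
    apply/eqP; rewrite -tofrac_eq0; apply/eqP; rewrite -[RHS]bfE PE.
    by rewrite !(rmorphD, rmorphM, rmorphXn, rmorph_nat).
  have bP : b%:R != 0 :> {poly rat}.
    by rewrite -(polyC_natr rat b) polyC_eq0 pnatr_eq0 -lt0n.
  apply: (mulfI bP); apply/eqP; rewrite -subr_eq0 -oppr_eq0 -bfE Pf.
  by apply/eqP; ring.
have [k [s uE]] := norm_one_Fpoly ha hb N.
have e0 := ratfun_expNb_neq0 k.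
have yE : FracField.tofrac y * (- b%:R) ^+ k = (- b%:R) ^+ k
    + (-1) ^+ s * (F k.+1 ^+ 2 + b%:R * F k ^+ 2).
  have [FE _] := Fpoly_double a b k.
  have := congr1 ratfun_of_zpoly FE.
  rewrite !(rmorphD, rmorphM, rmorphXn, rmorph_nat) => <-.
  have := congr1 (@FracField.tofrac _) uE.
  rewrite !(rmorphD, rmorphM, rmorphXn, rmorphN, rmorph_nat, rmorph1) /= => <-.
  by ring.
have [LE LE'] := ratfun_Lpoly k.
(* s is true for u = - F_(2k+1) / (-b)^k, the case y = - F_k L_(k+1) / (-b)^k. *)
exists k; case: s uE yE => uE yE; [right|left]; apply: (mulIf e0).
  by rewrite divfK // yE LE' ratfun_Fpoly_norm expr1; ring.
by rewrite divfK // yE LE ratfun_Fpoly_norm expr0; ring.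
Qed.

End Parametrization.

Theorem theorem1p3 (a b : nat) (ha : (0 < a)%N) (hb : (0 < b)%N)
    (hab : (b %| a)%N) (q : ratfun) :
  in_Zx (lgen a b q) <->
  ((exists i : nat,
      [\/ q = ratfun_of_zpoly (Fpoly a b i) / ratfun_of_zpoly (Fpoly a b i.+1),
          q = ratfun_of_zpoly (Lpoly a b i) / ratfun_of_zpoly (Lpoly a b i.+1)
        | q = - (ratfun_of_zpoly (Lpoly a b i.+1)
                 / (b%:R * ratfun_of_zpoly (Lpoly a b i)))])
   \/ (exists i : nat,
         (0 < i)%N /\
         q = - (ratfun_of_zpoly (Fpoly a b i.+1)
                / (b%:R * ratfun_of_zpoly (Fpoly a b i))))).
Proof.
rewrite lgen_in_Zx //; split=> [[k]|].
  rewrite lgen_eq_FL // lgen_eq_FLN // => -[[qE|qE]|[qE|qE]].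
  - by left; exists k; constructor 1.
  - by left; exists k; constructor 3.
  - by left; exists k; constructor 2.
  - by right; exists k.
case=> [[k qE]|[k qE]]; exists k; rewrite lgen_eq_FL // lgen_eq_FLN //.
  by case: qE; tauto.
by tauto.
Qed.
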